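(* Let $\rho$ be a partition. If $g_{\rho/\mu}=g_{\rho/\mu^T}$ for all partitions $\mu$, then $\rho=(n,n-1,\ldots,1)$ for some nonnegative integer $n$. Likewise, if $G_{\rho/\mu}=G_{\rho/\mu^T}$ for all partitions $\mu$, then $\rho=(n,n-1,\ldots,1)$ for some nonnegative integer $n$. (For $n=0$ this means $\rho=\emptyset$.)
   Context: For partitions, $\mu\subseteq\lambda$ means $\mu_i\le\lambda_i$ for all $i$; the skew Young diagram $Y(\lambda/\mu)$ consists of the cells of the (left-aligned, English-convention) Young diagram of $\lambda$ not in that of $\mu$, and $|\lambda/\mu|=|\lambda|-|\mu|$. The conjugate partition $\mu^T$ is obtained by reflecting the Young diagram over the main diagonal. Convention: $g_{\lambda/\mu}=0$ and $G_{\lambda/\mu}=0$ if $\mu\not\subseteq\lambda$. A reverse plane partition of shape $\lambda/\mu$ is a filling of the cells of $Y(\lambda/\mu)$ with positive integers, weakly increasing along each row and down each column; $x^P=\prod_i x_i^{w_i}$, where $w_i$ is the number of columns of $P$ containing $i$. The skew dual stable Grothendieck polynomial is $g_{\lambda/\mu}=\sum_P x^P$ over all reverse plane partitions $P$ of shape $\lambda/\mu$. For nonempty finite sets $A,B$ of positive integers, $A\le B$ means $\max A\le\min B$ and $A<B$ means $\max A<\min B$. A set-valued tableau of shape $\lambda/\mu$ is a filling of $Y(\lambda/\mu)$ with nonempty finite sets of positive integers, weakly increasing ($\le$) along rows and strictly increasing ($<$) down columns; $|T|$ is the sum of the sizes of the sets, and $x^T=\prod_i x_i^{m_i}$, where $m_i$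 is the number of times $i$ appears in $T$. The skew stable Grothendieck polynomial is $G_{\lambda/\mu}=\sum_T(-1)^{|T|-|\lambda/\mu|}x^T$ over all set-valued tableaux $T$ of shape $\lambda/\mu$. *)

(* Defs.v *)
From HB Require Import structures.
From mathcomp Require Import all_boot all_order all_algebra.
From mathcomp Require Import finmap.
From mathcomp Require Import boolp classical_sets functions cardinality fsbigop.

Set Implicit Arguments.
Unset Strict Implicit.
Unset Printing Implicit Defensive.

Import Order.TTheory GRing.Theory Num.Theory.

Local Open Scope classical_set_scope.
Local Open Scope nat_scope.

(* A partition is the sequence of its nonzero parts; lam_i is nth 0 lam i, with
   rows and columns numbered from 0. *)
Definition is_partition (lam : seq nat) : bool :=
  sorted geq lam && all (fun part => 0 < part) lam.

Definition contained (mu lam : seq nat) : Prop :=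
  forall i, nth 0 mu i <= nth 0 lam i.

(* The j-th part is the height of column j; see mem_diagram_conj. *)
Definition conj_part (lam : seq nat) : seq nat :=
  [seq count (fun part => j < part) lam | j <- iota 0 (nth 0 lam 0)].

Definition staircase (n : nat) : seq nat := rev (iota 1 n).

(* Cells are pairs (row, column). *)
Definition diagram (lam : seq nat) : {fset nat * nat} :=
  [fset ((i, j) : nat * nat) | i in iota 0 (size lam),
                               j in iota 0 (nth 0 lam i)]%fset.

Definition skew (lam mu : seq nat) : {fset nat * nat} :=
  (diagram lam `\` diagram mu)%fset.

Definition skew_size (lam mu : seq nat) : nat := sumn lam - sumn mu.

Definition row_of lam mu (c : skew lam mu) : nat := (val c).1.
Definition column_of lam mu (c : skew lam mu) : nat := (val c).2.

(* Formal power series over the integers in the variables x_i, given by their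
   coefficients.  An exponent is a finitely supported function of i.  The
   variables that occur are the x_i with i > 0, as the fillings below have
   positive entries; x_0 is a dummy. *)
Definition exponent : Type := {fsfun nat -> nat with 0}.
Definition fps : Type := exponent -> int.

(* The monomial \prod_i x_i^(w i), for w of finite support. *)
Definition monomial (w : nat -> nat) : fps := fun a => (`[< a =1 w >]%:R)%R.

Section Fillings.
Variables lam mu : seq nat.
Implicit Types c d : skew lam mu.

Definition is_rpp (P : {ffun skew lam mu -> nat}) : Prop :=
  [/\ forall c, 0 < P c,
      forall c d, row_of c = row_of d -> column_of c <= column_of d -> P c <= P d &
      forall c d, column_of c = column_of d -> row_of c <= row_of d -> P c <= P d].

Definition rpp_weight (P : {ffun skew lam mu -> nat}) (i : nat) : nat :=
  #|` [fset column_of c | c : skew lam mu & P c == i]%fset |.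

Definition fsmax (A : {fset nat}) : nat := \max_(a <- A) a.

(* The default value fsmax A matters only for A empty. *)
Definition fsmin (A : {fset nat}) : nat := \big[minn/fsmax A]_(a <- A) a.

Definition fsle (A B : {fset nat}) : Prop := fsmax A <= fsmin B.
Definition fslt (A B : {fset nat}) : Prop := fsmax A < fsmin B.

Definition is_svt (T : {ffun skew lam mu -> {fset nat}}) : Prop :=
  [/\ forall c, T c != fset0,
      forall c i, i \in T c -> 0 < i,
      forall c d, row_of c = row_of d -> column_of c < column_of d -> fsle (T c) (T d) &
      forall c d, column_of c = column_of d -> row_of c < row_of d -> fslt (T c) (T d)].

Definition svt_weight (T : {ffun skew lam mu -> {fset nat}}) (i : nat) : nat :=
  \sum_c (i \in T c).

Definition svt_size (T : {ffun skew lam mu -> {fset nat}}) : nat :=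
  \sum_c #|` T c |.

End Fillings.

Local Open Scope ring_scope.

(* In each coefficient, the sum over all fillings has finitely many nonzero
   terms (rpp_finite_support, svt_finite_support below), so the \sum_(_ \in _)
   of fsbigop is the sum of the power series. *)
Definition dual_grothendieck (lam mu : seq nat) : fps := fun a =>
  if `[< contained mu lam >] then
    \sum_(P \in [set P : {ffun skew lam mu -> nat} | is_rpp P])
      monomial (rpp_weight P) a
  else 0.

Definition grothendieck (lam mu : seq nat) : fps := fun a =>
  if `[< contained mu lam >] then
    \sum_(T \in [set T : {ffun skew lam mu -> {fset nat}} | is_svt T])
      (-1) ^+ (svt_size T - skew_size lam mu)%N * monomial (svt_weight T) a
  else 0.

Local Close Scope ring_scope.

Lemma mem_diagram lam i j : ((i, j) \in diagram lam) = (j < nth 0 lam i).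
Proof.
apply/imfset2P/idP => [[i' _ [j' + [-> ->]]]|ltj].
  by rewrite mem_iota.
exists i; last by exists j; rewrite //= mem_iota.
by rewrite /= mem_iota /=; case: (ltnP i (size lam)) ltj => // /(nth_default 0)->.
Qed.

Lemma count_gt_sorted lam i j : is_partition lam ->
  (i < count (fun part => j < part) lam) = (j < nth 0 lam i).
Proof.
case/andP => + _; elim: lam i => [|p lam IH] i /= pth; first by rewrite nth_nil.
have gep : all (geq p) lam.
  by apply: order_path_min pth => x y z yx zy; exact: leq_trans zy yx.
have := IH _ (path_sorted pth).
case: (ltnP j p) => jp /= IHi; first by case: i => [|i] /=; rewrite ?jp ?ltnS.
have -> : count (fun part => j < part) lam = 0.
  apply/eqP; rewrite -leqn0 leqNgt -has_count; apply/hasPn => x /(allP gep) xp.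
  by rewrite -leqNgt (leq_trans xp).
case: i {IHi} => [|i] /=; first by rewrite [in RHS]ltnNge jp.
apply/esym/negbTE; rewrite -leqNgt; case: (ltnP i (size lam)) => isz.
  exact: leq_trans (allP gep _ (mem_nth 0 isz)) jp.
by rewrite nth_default.
Qed.

Lemma mem_diagram_conj lam i j : is_partition lam ->
  ((i, j) \in diagram (conj_part lam)) = ((j, i) \in diagram lam).
Proof.
move=> plam; rewrite !mem_diagram; case: (ltnP i (nth 0 lam 0)) => i0.
  by rewrite (nth_map 0) ?size_iota // nth_iota // count_gt_sorted.
rewrite nth_default ?size_map ?size_iota // ltn0; apply/esym/negbTE.
apply: contraL i0; rewrite -ltnNge -!count_gt_sorted //.
exact: leq_ltn_trans (leq0n j).
Qed.

Lemma conj_partition lam : is_partition lam -> is_partition (conj_part lam).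
Proof.
move=> plam; apply/andP; split.
  apply: (homo_sorted (e := leq)); last exact: iota_sorted.
  by move=> i j ij; apply: sub_count => x /=; exact: leq_ltn_trans.
apply/allP => _ /mapP[j + ->]; rewrite mem_iota /= add0n.
by rewrite count_gt_sorted.
Qed.

Lemma rpp_finite_support lam mu (a : exponent) :
  finite_set [set P : {ffun skew lam mu -> nat} |
                is_rpp P /\ monomial (rpp_weight P) a <> 0%R].
Proof.
pose N := (\max_(i <- finsupp a) i).+1.
apply: (@sub_finite_set _ _
  [set [ffun c => val (Q c)] | Q in [set: {ffun skew lam mu -> 'I_N}]]); last first.
  exact/finite_image/finite_finset.
move=> P [_]; rewrite /monomial; case: asboolP => // aP _ /=.
have ltP c : P c < N.
  rewrite ltnS; apply: (@leq_bigmax_seq _ _ xpredT (fun i : nat => i)) => //.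
  rewrite mem_finsupp aP -lt0n cardfs_gt0; apply/fset0Pn; exists (column_of c).
  by apply/imfsetP; exists c => //=; rewrite inE.
exists [ffun c => Ordinal (ltP c)] => //.
by apply/ffunP => c; rewrite !ffunE.
Qed.

Lemma svt_finite_support lam mu (a : exponent) :
  finite_set [set T : {ffun skew lam mu -> {fset nat}} |
                is_svt T /\ monomial (svt_weight T) a <> 0%R].
Proof.
apply: (@sub_finite_set _ _
  [set [ffun c => [fsetval x in Q c]%fset] |
     Q in [set: {ffun skew lam mu -> {set finsupp a}}]]); last first.
  exact/finite_image/finite_finset.
move=> T [_]; rewrite /monomial; case: asboolP => // aT _ /=.
have subT c i : i \in T c -> i \in finsupp a.
  move=> iT; rewrite mem_finsupp aT /svt_weight (bigD1 c) //= iT.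
  by rewrite addn_eq0.
exists [ffun c => [set x : finsupp a | val x \in T c]%SET] => //.
apply/ffunP => c; rewrite !ffunE; apply/fsetP => i.
apply/imfsetP/idP => [[x /=]|iT]; first by rewrite inE => xT ->.
by exists [` subT c i iT]%fset => //=; rewrite inE.
Qed.

(* Main.v *)
From mathcomp Require Import all_algebra zify.
Require Import Defs.
From mathcomp Require Import all_boot.
From mathcomp Require Import finmap boolp classical_sets fsbigop.

(** Only the coefficients of the powers of x_1 matter.  In g_(rho/mu) the
    coefficient of x_1^k is nonzero iff rho/mu has exactly k columns, and in
    G_(rho/mu) that of x_1^|rho/mu| is nonzero iff rho/mu has no two cells in
    the same column.  With mu = rho, either hypothesis gives rho^T = rho.  A
    self-conjugate rho which is not a staircase has a row exceeding the next one
    by at least 2; removing the last two cells of this row gives mu for which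
    rho/mu is a horizontal domino and rho/mu^T a vertical one. *)

Set Implicit Arguments.
Unset Strict Implicit.
Unset Printing Implicit Defensive.

(** * Exponents of the powers of x_1, and sums or sets with a single relevant element *)

Definition x1_power (k : nat) : exponent := [fsfun i in [fset 1]%fset => k].

Lemma x1_powerE k i : x1_power k i = if i == 1 then k else 0.
Proof. by rewrite fsfunE inE. Qed.

Lemma x1_power_gt0 k i : 0 < x1_power k i -> i = 1.
Proof. by rewrite x1_powerE; case: eqP. Qed.

Lemma x1_power_inj k l : x1_power k =1 x1_power l -> k = l.
Proof. by move/(_ 1); rewrite !x1_powerE. Qed.

Lemma fsbig_only (T : choiceType) (V : nmodType) (D : set T) (x : T) (F : T -> V) :
  D x -> (forall y, D y -> y <> x -> F y = 0%R) ->
  (\sum_(y \in D) F y)%R = F x.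
Proof.
move=> Dx F0; rewrite -(fsbig_widen [set x]%classic) ?fsbig_set1 //.
- by move=> _ ->.
- by move=> y [Dy]; exact: F0.
Qed.

Lemma fset1_seq (T : choiceType) (x : T) : [fset x]%fset = [:: x] :> seq T.
Proof.
apply: perm_small_eq => //; apply: uniq_perm => // y.
by rewrite in_fset1 mem_seq1.
Qed.

Lemma fsmax1 i : fsmax [fset i]%fset = i.
Proof. by rewrite /fsmax fset1_seq big_seq1. Qed.

Lemma fsmin1 i : fsmin [fset i]%fset = i.
Proof. by rewrite /fsmin fsmax1 fset1_seq big_cons big_nil minnn. Qed.

(** * Coefficients of the powers of x_1 in both series *)

Section PowersOfX1.
Variables lam mu : seq nat.
Implicit Type k : nat.

Definition columns : {fset nat} := [fset c.2 | c in skew lam mu]%fset.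

Lemma is_rpp_one : is_rpp [ffun _ : skew lam mu => 1].
Proof. by split=> [c|c d|c d]; rewrite !ffunE. Qed.

Lemma rpp_weight_one i :
  rpp_weight [ffun _ : skew lam mu => 1] i = x1_power #|` columns| i.
Proof.
rewrite x1_powerE /rpp_weight /columns; case: eqP => [->|i1].
  congr #|` _|; apply/fsetP => j; apply/imfsetP/imfsetP => /= [[c _ ->]|[c cl ->]].
    by exists (val c) => //; exact: valP.
  by exists [` cl]%fset => //; rewrite inE ffunE.
apply/eqP; rewrite cardfs_eq0 -fsubset0; apply/fsubsetP => j /imfsetP[c /=].
by rewrite inE ffunE => /eqP/esym.
Qed.

(** Every entry of [P] lies in some column, so it has positive weight, and 1 is the only index at
    which [x1_power k] can be positive. *)
Lemma rpp_x1_power k (P : {ffun skew lam mu -> nat}) :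
  x1_power k =1 rpp_weight P -> P = [ffun=> 1].
Proof.
move=> kP; apply/ffunP => c; rewrite ffunE; apply: (@x1_power_gt0 k).
rewrite kP cardfs_gt0; apply/fset0Pn; exists (column_of c).
by apply/imfsetP; exists c; rewrite //= inE.
Qed.

(** By [rpp_x1_power] only the all-ones filling can contribute; it is always a reverse plane
    partition, and its weight at 1 is the number of columns. *)
Lemma dual_grothendieck_x1_power k :
  dual_grothendieck lam mu (x1_power k) <> 0%R <->
  contained mu lam /\ k = #|` columns|.
Proof.
rewrite /dual_grothendieck; case: asboolP => [cml|]; last by split=> [|[]].
rewrite (fsbig_only is_rpp_one) => [|P _ P1]; rewrite /monomial; last first.
  by case: asboolP => // /rpp_x1_power.
case: asboolP => [E|nE]; split=> [_|[_ ek]] //.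
  by split=> //; apply: x1_power_inj => i; rewrite E rpp_weight_one.
by case: nE => i; rewrite rpp_weight_one ek.
Qed.

(** For the constant filling the row condition reads 1 <= 1, while the column condition reads 1 < 1
    and fails as soon as two cells share a column. *)
Lemma is_svt_one : {in skew lam mu &, injective snd} <->
  is_svt [ffun _ : skew lam mu => [fset 1]%fset].
Proof.
split=> [inj|[_ _ _ colT] c d cs ds].
  split=> [c|c i|c d _ _|c d cd lcd]; rewrite ?ffunE.
  - by apply/fset0Pn; exists 1; rewrite inE.
  - by rewrite inE => /eqP->.
  - by rewrite /fsle fsmax1 fsmin1.
  - by move: lcd; rewrite /row_of (inj _ _ (valP c) (valP d) cd) ltnn.
have noLt (a b : skew lam mu) : (val a).2 = (val b).2 -> ~~ ((val a).1 < (val b).1).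
  by move=> ab; apply/negP => /(colT _ _ ab); rewrite !ffunE /fslt fsmax1 fsmin1.
move=> cd; have := noLt [` cs]%fset [` ds]%fset cd.
have := noLt [` ds]%fset [` cs]%fset (esym cd).
rewrite /= -!leqNgt => le1 le2.
apply/eqP; rewrite [c]surjective_pairing [d]surjective_pairing xpair_eqE.
by rewrite eqn_leq le1 le2 cd eqxx.
Qed.

Lemma svt_weight_one i :
  svt_weight [ffun _ : skew lam mu => [fset 1]%fset] i = x1_power #|` skew lam mu| i.
Proof.
rewrite x1_powerE /svt_weight; under eq_bigr => c _ do rewrite ffunE inE.
by rewrite sum_nat_const -cardfE; case: eqP; rewrite ?muln1 ?muln0.
Qed.

(** Any element of an entry has positive weight, hence equals 1; since entries are nonempty, each is
    {1}. *)
Lemma svt_x1_power k (T : {ffun skew lam mu -> {fset nat}}) :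
  is_svt T -> x1_power k =1 svt_weight T -> T = [ffun=> [fset 1]%fset].
Proof.
move=> [T0 _ _ _] kT; apply/ffunP => c; rewrite ffunE.
have T1 i : i \in T c -> i = 1.
  by move=> iT; apply: (@x1_power_gt0 k); rewrite kT /svt_weight (bigD1 c) //= iT.
apply/fsetP => i; rewrite inE; apply/idP/eqP => [|->]; first exact: T1.
by have /fset0Pn[j jT] := T0 c; rewrite -(T1 j jT).
Qed.

Lemma grothendieck_x1_power k :
  grothendieck lam mu (x1_power k) <> 0%R <->
  [/\ contained mu lam, k = #|` skew lam mu| & {in skew lam mu &, injective snd}].
Proof.
rewrite /grothendieck; case: asboolP => [cml|]; last by split=> [|[]].
split=> [N0|[_ ek /is_svt_one svt1]].
  have [T svtT kT] : exists2 T : {ffun skew lam mu -> {fset nat}},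
      is_svt T & x1_power k =1 svt_weight T.
    (* Without a tableau of this weight, every term of the sum would vanish. *)
    apply: contrapT => noT; apply: N0; apply: fsbig1 => T svtT.
    by rewrite /monomial; case: asboolP => kT; [case: noT; exists T | rewrite GRing.mulr0].
  have T1 := svt_x1_power svtT kT; rewrite {}T1 in svtT kT; split=> //.
    by apply: x1_power_inj => i; rewrite kT svt_weight_one.
  exact/is_svt_one.
rewrite (fsbig_only svt1) => [|T svtT T1]; rewrite /monomial.
  case: asboolP => [_|[]]; last by move=> i; rewrite svt_weight_one ek.
  (* The coefficient is a power of -1, hence nonzero. *)
  by rewrite GRing.mulr1; apply/eqP; rewrite GRing.signr_eq0.
by case: asboolP => [/(svt_x1_power svtT)//|_]; rewrite GRing.mulr0.
Qed.

End PowersOfX1.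

(** * Skew diagrams, partitions given by row lengths, and staircases *)

Lemma mem_skew lam mu i j :
  ((i, j) \in skew lam mu) = (nth 0 mu i <= j < nth 0 lam i).
Proof. by rewrite in_fsetD !mem_diagram -leqNgt. Qed.

Lemma skewvv lam : skew lam lam = fset0.
Proof. exact: fsetDv. Qed.

Lemma containedvv lam : contained lam lam.
Proof. by move=> i. Qed.

(** Puts containment in terms of cells, on which conjugation acts by swapping coordinates. *)
Lemma containedP mu lam :
  contained mu lam <-> {subset diagram mu <= diagram lam}.
Proof.
split=> [cml [i j]|sub i].
  by rewrite !mem_diagram => /leq_trans; apply.
by case Ei: (nth 0 mu i) => [//|m]; rewrite -mem_diagram sub // mem_diagram Ei.
Qed.

Lemma nth_partition lam i j : is_partition lam -> i <= j -> nth 0 lam j <= nth 0 lam i.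
Proof.
move=> /andP[srt _] ij; have [jl|/(nth_default 0)->//] := ltnP j (size lam).
have geq_trans : transitive geq by move=> x y z yx zy; exact: leq_trans zy yx.
by apply: (sorted_leq_nth geq_trans leqnn 0 srt); rewrite ?inE ?(leq_ltn_trans ij).
Qed.

Lemma exists_partition (f : nat -> nat) n : (forall i, f i.+1 <= f i) -> f n = 0 ->
  exists2 mu, is_partition mu & forall i, nth 0 mu i = f i.
Proof.
elim: n f => [|n IH] f fS fn0.
  exists [::] => // i; rewrite nth_nil; elim: i => [//|i IHi].
  by apply/esym/eqP; rewrite -leqn0 IHi.
have [|//|mu pmu fmu] := IH (fun i => f i.+1); first by move=> i; exact: fS.
(* Parts must be positive: once [f] reaches 0 it stays there and the sequence stops. *)
have [f0|f0] := posnP (f 0).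
  exists [::] => // i; rewrite nth_nil; elim: i => [//|i IHi].
  by apply/esym/eqP; rewrite -leqn0 IHi.
exists (f 0 :: mu) => [|[|i] //=].
move: pmu => /andP[smu amu]; rewrite /is_partition /= f0 amu !andbT.
by case: mu smu fmu {amu} => [//|m mu] /= -> /(_ 0)/= ->; rewrite fS.
Qed.

Lemma staircaseS n : staircase n.+1 = n.+1 :: staircase n.
Proof. by rewrite /staircase -[n.+1]addn1 iotaD rev_cat /= add1n addn1. Qed.

(** At the last row the next part is the default 0, so the last part is 1 and the parts grow by 1
    going up. *)
Lemma staircase_of_steps lam :
  (forall i, i < size lam -> nth 0 lam i = (nth 0 lam i.+1).+1) ->
  lam = staircase (size lam).
Proof.
elim: lam => [//|p lam IH] steps; rewrite [size _]/= staircaseS.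
have <- : lam = staircase (size lam) by apply: IH => i; exact: (steps i.+1).
have /= -> := steps 0 isT; rewrite IH => [|i]; last exact: (steps i.+1).
by case: (size lam) => [//|n]; rewrite !staircaseS /= size_rev size_iota.
Qed.

(** * Self-conjugate partitions and dominoes *)

Section SelfConjugate.
Variable rho : seq nat.
Hypothesis prho : is_partition rho.
Hypothesis rhoT : forall i j, ((i, j) \in diagram rho) = ((j, i) \in diagram rho).

Lemma mem_skew_conj mu i j : is_partition mu ->
  ((i, j) \in skew rho (conj_part mu)) = ((j, i) \in skew rho mu).
Proof. by move=> pmu; rewrite !in_fsetD mem_diagram_conj // rhoT. Qed.

(* If rows i and i.+1 have the same length v > 0, so have columns i and i.+1,
   hence row v.-1 exceeds row v by at least 2. *)
Lemma self_conjugate_step : (forall n, rho <> staircase n) ->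
  exists i, (nth 0 rho i.+1).+1 < nth 0 rho i.
Proof.
move=> nst; apply: contrapT => noi.
have step i : nth 0 rho i <= (nth 0 rho i.+1).+1.
  by rewrite leqNgt; apply/negP => lt; apply: noi; exists i.
apply: (nst (size rho)); apply: staircase_of_steps => i ir.
apply/eqP; rewrite eqn_leq step /= ltn_neqAle nth_partition // andbT.
apply/eqP => eqi; move: (ir) => /(mem_nth 0).
case/andP: prho => _ /allP/[apply]; case Ei: (nth 0 rho i) => [//|v] _.
(* Here [v.+1] is the common length of the two rows: row [v] contains column [i.+1], whereas row
   [v.+1] misses column [i], a drop of at least 2. *)
have vi : i.+1 < nth 0 rho v by rewrite -mem_diagram rhoT mem_diagram eqi Ei.
have : (v.+1, i) \notin diagram rho by rewrite rhoT mem_diagram Ei ltnn.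
by rewrite mem_diagram -leqNgt => le; have := step v; lia.
Qed.

Lemma horizontal_domino i : (nth 0 rho i.+1).+1 < nth 0 rho i ->
  exists j mu, [/\ is_partition mu, contained mu rho &
    skew rho mu = [fset (i, j); (i, j.+1)]%fset].
Proof.
(* Shortening row [i] by two keeps the row lengths weakly decreasing, because it exceeds the next
   row by at least 2. *)
move=> drop; pose f k := if k == i then nth 0 rho i - 2 else nth 0 rho k.
have f_le k : f k <= nth 0 rho k by rewrite /f; case: eqP => [->|_]; lia.
have [k||mu pmu muE] := @exists_partition f (size rho).
- rewrite {2}/f; case: eqP => [->|_]; first by rewrite /f; case: eqP; lia.
  exact: leq_trans (f_le _) (nth_partition prho (leqnSn k)).
- by apply/eqP; rewrite -leqn0 (leq_trans (f_le _)) // nth_default.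
exists (nth 0 rho i - 2), mu; split=> // [k|]; first by rewrite muE.
apply/fsetP => [[k l]]; rewrite mem_skew muE /f !inE !xpair_eqE.
by case: eqP => [->|_] /=; lia.
Qed.

Lemma domino_columns i j mu : skew rho mu = [fset (i, j); (i, j.+1)]%fset ->
  #|` columns rho mu| = 2.
Proof.
by move=> Es; rewrite /columns Es imfset_fset2 /= cardfs2 ltn_eqF.
Qed.

Lemma domino_conj i j mu : is_partition mu ->
  skew rho mu = [fset (i, j); (i, j.+1)]%fset ->
  skew rho (conj_part mu) = [fset (j, i); (j.+1, i)]%fset.
Proof.
move=> pmu Es; apply/fsetP => [[k l]].
by rewrite mem_skew_conj // Es !inE !xpair_eqE ![(l == i) && _]andbC.
Qed.

Lemma domino_conj_columns i j mu : is_partition mu ->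
  skew rho mu = [fset (i, j); (i, j.+1)]%fset ->
  #|` columns rho (conj_part mu)| = 1.
Proof.
move=> pmu /(domino_conj pmu) Es.
by rewrite /columns Es imfset_fset2 /= fsetUid cardfs1.
Qed.

End SelfConjugate.

(** * From the symmetry hypotheses to staircases *)

Lemma self_conjugate rho : is_partition rho -> contained (conj_part rho) rho ->
  forall i j, ((i, j) \in diagram rho) = ((j, i) \in diagram rho).
Proof.
move=> prho /containedP sub.
(* Transposition is an involution, so one inclusion yields the other. *)
have half i j : (i, j) \in diagram rho -> (j, i) \in diagram rho.
  by rewrite -mem_diagram_conj // => /sub.
by move=> i j; apply/idP/idP; exact: half.
Qed.

Lemma not_forall_staircase rho :
  ~ (forall n, rho <> staircase n) -> exists n, rho = staircase n.
Proof. by move=> h; apply: contrapT => nex; apply: h => n E; apply: nex; exists n. Qed.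

Theorem theorem2p32 (rho : seq nat) (hrho : is_partition rho) :
  ((forall mu : seq nat, is_partition mu ->
      dual_grothendieck rho mu = dual_grothendieck rho (conj_part mu)) ->
    exists n : nat, rho = staircase n)
  /\
  ((forall mu : seq nat, is_partition mu ->
      grothendieck rho mu = grothendieck rho (conj_part mu)) ->
    exists n : nat, rho = staircase n).
Proof.
split=> sym; apply: not_forall_staircase => nst.
  (* The coefficient tested is that of x_1^k with k the number of columns of rho/mu. *)
  have transfer mu : is_partition mu -> contained mu rho ->
      contained (conj_part mu) rho /\
      #|` columns rho mu| = #|` columns rho (conj_part mu)|.
    by move=> pmu cmu; apply/dual_grothendieck_x1_power; rewrite -sym //;
      apply/dual_grothendieck_x1_power.
  have [cT _] := transfer _ hrho (containedvv rho).
  have rhoT := self_conjugate hrho cT.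
  have [i /(horizontal_domino hrho)[j [mu [pmu cmu Es]]]] :=
    self_conjugate_step hrho rhoT nst.
  (* The horizontal domino has 2 columns, its transpose only 1. *)
  have [_] := transfer mu pmu cmu.
  by rewrite (domino_columns Es) (domino_conj_columns rhoT pmu Es).
have transfer mu : is_partition mu -> contained mu rho ->
    {in skew rho mu &, injective snd} ->
    contained (conj_part mu) rho /\ {in skew rho (conj_part mu) &, injective snd}.
  move=> pmu cmu inj.
  (* The coefficient tested is that of x_1 to the number of cells of rho/mu. *)
  suff /grothendieck_x1_power[] :
    grothendieck rho (conj_part mu) (x1_power #|` skew rho mu|) <> 0%R by [].
  by rewrite -sym //; apply/grothendieck_x1_power.
have [|cT _] := transfer _ hrho (containedvv rho); first by rewrite skewvv.
have rhoT := self_conjugate hrho cT.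
have [i /(horizontal_domino hrho)[j [mu [pmu cmu Es]]]] :=
  self_conjugate_step hrho rhoT nst.
have [|_] := transfer mu pmu cmu.
  by move=> c d; rewrite Es => /fset2P[]-> /fset2P[]-> //=; lia.
(* The vertical domino has two cells in column [i], against injectivity. *)
rewrite (domino_conj rhoT pmu Es) => /(_ (j, i) (j.+1, i)).
by rewrite !inE !eqxx orbT => /(_ isT isT erefl)[] /n_Sn.
Qed.
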